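(* Let $\Phi$ be of type $C_n$ and $W=W(C_n)$. Let $\mathsf{s}_1,\mathsf{s}_2$ be sections of $1\to\mathbb{Z}\Phi\to\mathbb{Z}\Phi\rtimes W\xrightarrow{\pi}W\to1$, with $\mathsf{s}_1(s_i)=\tau_{a_i\alpha_i}s_i$ and $\mathsf{s}_2(s_i)=\tau_{b_i\alpha_i}s_i$, $a_i,b_i\in\mathbb{Z}$, and put $d_i=a_i-b_i$ for $i=1,\dots,n$. Let $I_n=\{k\in\{1,\dots,n\}:k\text{ is odd}\}$. Then $\mathsf{s}_1$ and $\mathsf{s}_2$ define two different elements in $H^1(W,\mathbb{Z}\Phi)$ if and only if $$\sum_{k\in I_n}\overline{d_k}=1\quad\text{in }\mathbb{Z}/2\mathbb{Z}.$$
   Context: $\Phi$ is the root system of type $C_n$ ($n\ge2$) in a Euclidean space $V$ spanned by it, with simple roots $\alpha_1,\dots,\alpha_n$ numbered in order along the Dynkin diagram, $\alpha_n$ being the long simple root; $W$ is its Weyl group, generated by the simple reflections $s_i=s_{\alpha_i}$. $\mathbb{Z}\Phi$ is the root lattice, with $x\in\mathbb{Z}\Phi$ written as the translation $\tau_x$ in $\mathbb{Z}\Phi\rtimes W$. A section is a group morphism $\mathsf{s}:W\to\mathbb{Z}\Phi\rtimes W$ with $\pi\circ\mathsf{s}=\mathrm{id}_W$; every section is of the form $s_i\mapsto\tau_{k_i\alpha_i}s_i$ for a unique $(k_1,\dots,k_n)\in\mathbb{Z}^n$, and every such tuple occurs. $H^1(W,\mathbb{Z}\Phi)$ is identified with the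 set of sections up to conjugation by elements of $\mathbb{Z}\Phi$ (a section $\mathsf{s}(g)=\tau_{f(g)}g$ corresponds to the class of the 1-cocycle $f$), so two sections define the same element iff there is $z\in\mathbb{Z}\Phi$ with $\mathsf{s}_2(g)=\tau_z\mathsf{s}_1(g)\tau_{-z}$ for all $g\in W$. The bar denotes the class modulo $2$. *)

(* Defs.v *)
From HB Require Import structures.
From mathcomp Require Import all_boot all_order all_algebra.
From mathcomp Require Import ring_quotient sesquilinear.
From mathcomp Require Import boolp classical_sets functions reals.

Set Implicit Arguments.
Unset Strict Implicit.
Unset Printing Implicit Defensive.

Import Order.TTheory GRing.Theory Num.Theory.

Local Open Scope ring_scope.

Record zaction (W : groupType) (L : zmodType) := ZAction {
  zact :> W -> L -> L;
  zact1 : forall x, zact 1%g x = x;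
  zactM : forall g h x, zact (g * h)%g x = zact g (zact h x);
  zactD : forall g x y, zact g (x + y) = zact g x + zact g y }.

(* The pair (x, g) stands for tau_x g, so g * tau_x = tau_(g x) * g. The phantom
   argument makes the group structure depend on the action. *)
Definition sdprod (W : groupType) (L : zmodType) of zaction W L : Type :=
  (L * W)%type.

Section SemidirectProduct.
Variables (W : groupType) (L : zmodType) (A : zaction W L).

Lemma zact0 g : A g 0 = 0.
Proof. by apply: (addrI (A g 0)); rewrite -zactD !addr0. Qed.

Lemma zactN g x : A g (- x) = - A g x.
Proof. by apply: (addrI (A g x)); rewrite -zactD !subrr zact0. Qed.

Local Notation sdprod := (sdprod A).
HB.instance Definition _ := Choice.copy sdprod (L * W)%type.

Definition sd_mul (u v : sdprod) : sdprod :=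
  (u.1 + A u.2 v.1, (u.2 * v.2)%g).
Definition sd_one : sdprod := (0, 1%g).
Definition sd_inv (u : sdprod) : sdprod := (- A u.2^-1%g u.1, u.2^-1%g).

Lemma sd_mulA : associative sd_mul.
Proof.
by move=> u v w; rewrite /sd_mul /= zactM zactD addrA mulgA.
Qed.
Lemma sd_mul1g : left_id sd_one sd_mul.
Proof. by case=> x g; rewrite /sd_mul /= zact1 add0r mul1g. Qed.
Lemma sd_mulg1 : right_id sd_one sd_mul.
Proof. by case=> x g; rewrite /sd_mul /= zact0 addr0 mulg1. Qed.
Lemma sd_mulVg : left_inverse sd_one sd_inv sd_mul.
Proof. by case=> x g; rewrite /sd_mul /= addNr mulVg. Qed.
Lemma sd_mulgV : right_inverse sd_one sd_inv sd_mul.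
Proof.
by case=> x g; rewrite /sd_mul /= zactN -zactM mulgV zact1 subrr.
Qed.

HB.instance Definition _ :=
  isGroup.Build sdprod sd_mulA sd_mul1g sd_mulg1 sd_mulVg sd_mulgV.

Definition sd_transl (x : L) : sdprod := (x, 1%g).
Definition sd_lift (g : W) : sdprod := (0, g).
Definition sd_proj (u : sdprod) : W := u.2.

Fact sd_projM : {morph sd_proj : u v / (u * v)%g}.
Proof. by []. Qed.
HB.instance Definition _ := isMultiplicative.Build sdprod W sd_proj sd_projM.

Record gsection := GSection {
  gsection_fun :> {multiplicative W -> sdprod};
  gsectionK : cancel gsection_fun sd_proj }.

End SemidirectProduct.

Section FirstCohomology.
Variables (W : groupType) (L : zmodType) (A : zaction W L).

Definition is_cocycle (f : W -> L) : Prop :=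
  forall g h, f (g * h)%g = f g + A g (f h).
Definition cocycle_pred : pred (W -> L) := fun f => `[< is_cocycle f >].

Lemma cocycle_zmod_closed : zmod_closed cocycle_pred.
Proof.
split=> [|f1 f2 /asboolP c1 /asboolP c2]; apply/asboolP => g h.
  by rewrite /= zact0 addr0.
rewrite -[LHS]/(f1 (g * h)%g - f2 (g * h)%g).
rewrite -[RHS]/(f1 g - f2 g + A g (f1 h - f2 h)).
by rewrite c1 c2 zactD zactN opprD addrACA.
Qed.
HB.instance Definition _ :=
  GRing.isZmodClosed.Build (W -> L) cocycle_pred cocycle_zmod_closed.

Definition cocycle : Type := {f : W -> L | f \in cocycle_pred}.
HB.instance Definition _ := SubChoice.on cocycle.
HB.instance Definition _ := [SubChoice_isSubZmodule of cocycle by <:].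

Definition coboundary : pred cocycle :=
  fun f => `[< exists z, forall g, val f g = A g z - z >].

Lemma coboundary_zmod_closed : zmod_closed coboundary.
Proof.
split=> [|f1 f2 /asboolP[z1 e1] /asboolP[z2 e2]]; apply/asboolP.
  by exists 0 => g; rewrite zact0 subrr.
exists (z1 - z2) => g; rewrite -[LHS]/(val f1 g - val f2 g) e1 e2.
by rewrite zactD zactN opprD addrACA -opprD.
Qed.
HB.instance Definition _ :=
  GRing.isZmodClosed.Build cocycle coboundary coboundary_zmod_closed.

Definition H1 : Type :=
  {ideal_quot GRing.ZmodClosed.clone cocycle coboundary _}.
HB.instance Definition _ := ZmodQuotient.on H1.

Lemma gsection_is_cocycle (s : gsection A) :
  (fun g => (s g).1) \in cocycle_pred.
Proof.
apply/asboolP => g h; rewrite gmulfM /=.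
by have -> : (s g).2 = g := gsectionK s g.
Qed.

(* The 1-cocycle f such that s(g) = tau_(f g) g. *)
Definition gsection_cocycle (s : gsection A) : cocycle :=
  exist _ (fun g => (s g).1) (gsection_is_cocycle s).

Definition H1_class (s : gsection A) : H1 := (\pi_H1 (gsection_cocycle s))%qT.

End FirstCohomology.

Section RootSystem.
Variables (R : realType) (V : vectType R) (dot : {dot V for idfun}).

(* <v, a^vee> = 2 (v, a) / (a, a) *)
Definition cartan_int (v a : V) : R := 2 * dot v a / dot a a.

Definition refl_fun (a v : V) : V := v - cartan_int v a *: a.

Lemma refl_fun_linear a : linear (refl_fun a).
Proof.
move=> k u v; rewrite /refl_fun /cartan_int linearDl linearZl_LR /=.
by rewrite mulrDr mulrDl scalerDl scalerBr scalerA addrACA -opprD mulrCA !mulrA.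
Qed.
HB.instance Definition _ a :=
  GRing.isLinear.Build R V V *:%R (refl_fun a) (refl_fun_linear a).

Definition refl (a : V) : 'End(V) := linfun (refl_fun a).

Record root_system := RootSystem {
  roots :> seq V;
  roots_neq0 : 0 \notin roots;
  roots_span : <<roots>>%VS = fullv;
  roots_refl : forall a b, a \in roots -> b \in roots -> refl a b \in roots;
  roots_int : forall a b, a \in roots -> b \in roots ->
    cartan_int b a \in Num.int;
  roots_reduced : forall a (c : R), a \in roots -> c *: a \in roots ->
    c = 1 \/ c = -1 }.

End RootSystem.

Arguments root_system {R V} dot.

Section WeylGroup.
Variables (R : realType) (V : vectType R) (dot : {dot V for idfun}).
Variable Phi : root_system dot.
Local Notation s_ := (refl dot).

Lemma refl_fun_self (a : V) : a != 0 -> s_ a a = - a.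
Proof.
move=> a0; rewrite lfunE /= /refl_fun /cartan_int mulfK ?gt_eqF ?neq0_dnorm_gt0 //.
by rewrite scaler_nat mulr2n opprD addrA subrr add0r.
Qed.

Lemma refl_invol a : a \in roots Phi -> (s_ a \o s_ a)%VF = \1%VF.
Proof.
move=> aPhi; have a0 : a != 0.
  by apply: contraNneq (roots_neq0 Phi) => <-.
apply/lfunP => v; rewrite comp_lfunE id_lfunE.
rewrite [s_ a v]lfunE /= /refl_fun linearB linearZ /= refl_fun_self //.
by rewrite lfunE /= /refl_fun scalerN opprK subrK.
Qed.

(* Reflections are involutions, so the group they generate consists of their
   finite products. *)
Definition weyl_pred : pred 'End(V) := fun g =>
  `[< exists2 s : seq V, {subset s <= roots Phi} &
        g = \big[@comp_lfun R V V V / \1%VF]_(a <- s) s_ a >].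

Definition weyl : Type := {g : 'End(V) | g \in weyl_pred}.
HB.instance Definition _ := SubChoice.on weyl.

Lemma weyl_pred1 : \1%VF \in weyl_pred.
Proof. by apply/asboolP; exists [::]; rewrite ?big_nil. Qed.

Lemma weyl_predM g h :
  g \in weyl_pred -> h \in weyl_pred -> (g \o h)%VF \in weyl_pred.
Proof.
move=> /asboolP[s sP ->] /asboolP[t tP ->]; apply/asboolP.
exists (s ++ t); first by move=> a; rewrite mem_cat => /orP[/sP|/tP].
elim: s {sP} => [|a s IHs]; first by rewrite big_nil comp_lfun1l.
by rewrite /= !big_cons -IHs comp_lfunA.
Qed.

Lemma weyl_pred_refl a : a \in roots Phi -> s_ a \in weyl_pred.
Proof.
move=> aP; apply/asboolP; exists [:: a]; first by move=> b /[1!inE] /eqP ->.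
by rewrite big_seq1_id comp_lfun1r.
Qed.

Lemma weyl_pred_inv g : g \in weyl_pred ->
  exists2 h, h \in weyl_pred & (g \o h = \1 /\ h \o g = \1)%VF.
Proof.
move=> /asboolP[s sP ->]; elim: s sP => [|a s IHs] sP.
  exists \1%VF; first exact: weyl_pred1.
  by rewrite big_nil comp_lfun1l.
have aP : a \in roots Phi by apply/sP/mem_head.
have [|h hW [gh hg]] := IHs; first by move=> b bs; apply/sP/mem_behead.
exists (h \o s_ a)%VF; first exact/weyl_predM/weyl_pred_refl.
rewrite big_cons; set g' := (\big[_/_]_(_ <- _) _) in gh hg *; split.
  by rewrite -comp_lfunA (comp_lfunA g') gh comp_lfun1l refl_invol.
by rewrite -comp_lfunA (comp_lfunA (s_ a)) refl_invol // comp_lfun1l.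
Qed.

Lemma weyl_predV g : g \in weyl_pred -> (g^-1)%VF \in weyl_pred.
Proof.
move=> /weyl_pred_inv[h hW [gh hg]]; suff -> : (g^-1)%VF = h by [].
have kg : lker g == 0%VS.
  by apply/lker0P; apply: (can_inj (g := h)) => v; rewrite -comp_lfunE hg id_lfunE.
by rewrite -[LHS]comp_lfun1r -gh comp_lfunA lker0_compVf // comp_lfun1l.
Qed.

Lemma weyl_lker0 (g : weyl) : lker (val g) == 0%VS.
Proof.
have [h _ [_ hg]] := weyl_pred_inv (valP g).
by apply/lker0P; apply: (can_inj (g := h)) => v; rewrite -comp_lfunE hg id_lfunE.
Qed.

Definition weyl_one : weyl := Sub \1%VF weyl_pred1.
Definition weyl_mul (g h : weyl) : weyl :=
  Sub (val g \o val h)%VF (weyl_predM (valP g) (valP h)).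
Definition weyl_inv (g : weyl) : weyl :=
  Sub ((val g)^-1)%VF (weyl_predV (valP g)).

Lemma weyl_mulA : associative weyl_mul.
Proof. by move=> g h k; apply/val_inj; rewrite /= comp_lfunA. Qed.
Lemma weyl_mul1g : left_id weyl_one weyl_mul.
Proof. by move=> g; apply/val_inj; rewrite /= comp_lfun1l. Qed.
Lemma weyl_mulg1 : right_id weyl_one weyl_mul.
Proof. by move=> g; apply/val_inj; rewrite /= comp_lfun1r. Qed.
Lemma weyl_mulVg : left_inverse weyl_one weyl_inv weyl_mul.
Proof. by move=> g; apply/val_inj; rewrite /= lker0_compVf ?weyl_lker0. Qed.
Lemma weyl_mulgV : right_inverse weyl_one weyl_inv weyl_mul.
Proof. by move=> g; apply/val_inj; rewrite /= lker0_compfV ?weyl_lker0. Qed.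

HB.instance Definition _ :=
  isGroup.Build weyl weyl_mulA weyl_mul1g weyl_mulg1 weyl_mulVg weyl_mulgV.

Definition lattice_pred : pred V := fun x =>
  `[< inIntSpan (in_tuple (roots Phi)) x >].

Lemma lattice_zmod_closed : zmod_closed lattice_pred.
Proof.
split=> [|x y /asboolP[c ->] /asboolP[d ->]]; apply/asboolP.
  by exists [ffun=> 0]; rewrite big1 // => i _; rewrite ffunE mulr0z.
exists [ffun i => c i - d i]; rewrite -sumrB.
by apply: eq_bigr => i _; rewrite ffunE mulrzBr.
Qed.
HB.instance Definition _ :=
  GRing.isZmodClosed.Build V lattice_pred lattice_zmod_closed.

Definition root_lattice : Type := {x : V | x \in lattice_pred}.
HB.instance Definition _ := SubChoice.on root_lattice.
HB.instance Definition _ := [SubChoice_isSubZmodule of root_lattice by <:].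

Lemma root_in_lattice a : a \in roots Phi -> a \in lattice_pred.
Proof.
move=> aP; have lt_a : (index a (roots Phi) < size (roots Phi))%N
  by rewrite index_mem.
apply/asboolP; exists [ffun i => (i == Ordinal lt_a)%:Z].
rewrite (bigD1 (Ordinal lt_a)) //= ffunE eqxx mulr1z nth_index // big1 ?addr0 //.
by move=> i /negPf ni; rewrite ffunE ni mulr0z.
Qed.

Lemma weyl_lattice g x :
  g \in weyl_pred -> x \in lattice_pred -> g x \in lattice_pred.
Proof.
move=> /asboolP[s sP ->]; elim: s sP x => [|a s IHs] sP x xL.
  by rewrite big_nil id_lfunE.
rewrite big_cons comp_lfunE.
have /asboolP[c ->] : (\big[@comp_lfun R V V V / \1%VF]_(b <- s) s_ b) x
    \in lattice_pred by apply: IHs xL => b bs; apply/sP/mem_behead.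
rewrite linear_sum rpred_sum // => i _; rewrite raddfMz rpredMz //.
by apply/root_in_lattice/roots_refl; [apply/sP/mem_head | apply: mem_nth].
Qed.

Definition weyl_act_fun (g : weyl) (x : root_lattice) : root_lattice :=
  Sub (val g (val x)) (weyl_lattice (valP g) (valP x)).

Lemma weyl_act1 x : weyl_act_fun 1%g x = x.
Proof. by apply/val_inj; rewrite /= id_lfunE. Qed.
Lemma weyl_actM g h x :
  weyl_act_fun (g * h)%g x = weyl_act_fun g (weyl_act_fun h x).
Proof. by apply/val_inj; rewrite /= comp_lfunE. Qed.
Lemma weyl_actD g x y :
  weyl_act_fun g (x + y) = weyl_act_fun g x + weyl_act_fun g y.
Proof. by apply/val_inj; rewrite /= linearD. Qed.

Definition weyl_act : zaction weyl root_lattice :=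
  ZAction weyl_act1 weyl_actM weyl_actD.

(* A numbered base: every root is a combination of the simple roots with
   natural coefficients, or the opposite of one. *)
Record base (n : nat) := Base {
  simple :> 'I_n -> V;
  simple_root : forall i, simple i \in roots Phi;
  simple_basis : basis_of fullv [seq simple i | i : 'I_n];
  simple_sign : forall b, b \in roots Phi -> exists c : 'I_n -> nat,
    b = \sum_(i < n) simple i *+ c i \/ b = - \sum_(i < n) simple i *+ c i }.

Definition lattice_simple n (B : base n) (i : 'I_n) : root_lattice :=
  Sub (B i) (root_in_lattice (simple_root B i)).
Definition weyl_simple n (B : base n) (i : 'I_n) : weyl :=
  Sub (s_ (B i)) (weyl_pred_refl (simple_root B i)).

Definition cartanC (n : nat) (i j : nat) : int :=
  if i == j then 2
  else if j == i.+1 then -1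
  else if i == j.+1 then (if i.+1 == n then -2 else -1)
  else 0.

(* The entry (i, j) of the Cartan matrix is <alpha_i, alpha_j^vee>; indices
   start at 0 and the last simple root is the long one. *)
Definition type_C n (B : base n) : Prop :=
  forall i j : 'I_n, cartan_int dot (B i) (B j) = (cartanC n i j)%:~R.

End WeylGroup.

(* Main.v *)
(* The two cocycles differ by g z - z as soon as they do so on the simple
   reflections, since these generate W. On s_j this reads
   <z, alpha_j^vee> = - d_j, so the classes agree iff -d lies in the integral row
   space of the Cartan matrix. Modulo 2 the sum of the odd-numbered (in the
   numbering from 1) columns of that matrix is 0, which gives the obstruction;
   solving the system explicitly shows that there is no other one. *)
Require Import Defs.
From HB Require Import structures.
From mathcomp Require Import all_boot all_order all_algebra.
From mathcomp Require Import ring_quotient sesquilinear.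
From mathcomp Require Import boolp classical_sets functions reals.
From mathcomp Require Import zify ring.

Set Implicit Arguments.
Unset Strict Implicit.
Unset Printing Implicit Defensive.

Import Order.TTheory GRing.Theory Num.Theory.

Local Open Scope ring_scope.

(** * Classes of sections and their cocycles *)

Section Cohomology.
Variables (W : groupType) (L : zmodType) (A : zaction W L).

Lemma H1_class_eqP (s1 s2 : gsection A) :
  H1_class s1 = H1_class s2 <->
  exists z, forall g, (s1 g).1 - (s2 g).1 = A g z - z.
Proof.
rewrite /H1_class; split.
  by move=> /eqP; rewrite -Quotient.idealrBE => /asboolP.
by move=> h; apply/eqP; rewrite -Quotient.idealrBE; apply/asboolP.
Qed.

Lemma gsection_fstM (s : gsection A) g h :
  (s (g * h)%g).1 = (s g).1 + A g (s h).1.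
Proof. by have /asboolP := gsection_is_cocycle s; apply. Qed.

Lemma gsection_fst1 (s : gsection A) : (s 1%g).1 = 0.
Proof.
apply: (addrI (s 1%g).1).
by rewrite -{2}(zact1 A (s _).1) -gsection_fstM mulg1 addr0.
Qed.

Lemma sd_transl_lift_fst x g : (sd_transl A x * sd_lift A g)%g.1 = x.
Proof. by rewrite -[LHS]/(x + A 1%g 0) zact0 addr0. Qed.

End Cohomology.

(** * Reflections as isometric involutions *)

Section Reflections.
Variables (R : realType) (V : vectType R) (dot : {dot V for idfun}).
Local Notation s_ := (refl dot).

Lemma reflE a v : s_ a v = v - cartan_int dot v a *: a.
Proof. by rewrite lfunE. Qed.

Lemma dotC u v : dot u v = dot v u.
Proof. by rewrite hermC expr0 mul1r. Qed.

Lemma refl_isometry (a u v : V) : a != 0 -> dot (s_ a u) (s_ a v) = dot u v.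
Proof.
move=> a0; have aa : dot a a != 0 by rewrite gt_eqF ?neq0_dnorm_gt0.
rewrite !reflE !linearBl !linearBr !linearZl_LR !linearZr_LR /=.
rewrite /cartan_int (dotC a v) /=; by field; exact: aa.
Qed.

Lemma reflK (a : V) : a != 0 -> involutive (s_ a).
Proof.
move=> a0 v; rewrite [s_ a v]reflE linearB linearZ /= refl_fun_self // reflE.
by rewrite scalerN opprK subrK.
Qed.

(** Since [s_ a] is an isometric involution, pairing [v] with the coroot of [s_ a b] amounts to
    pairing [s_ a v] with the coroot of [b]. *)
Lemma refl_conj (a b : V) : a != 0 -> s_ (s_ a b) = (s_ a \o (s_ b \o s_ a))%VF.
Proof.
move=> a0; have cE v : cartan_int dot v (s_ a b) = cartan_int dot (s_ a v) b.
  rewrite /cartan_int -{1}[v](reflK a0).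
  by rewrite (refl_isometry (s_ a v) b a0) (refl_isometry b b a0).
apply/lfunP => v; rewrite !comp_lfunE reflE [s_ b _]reflE cE.
by rewrite [RHS]linearB [in RHS]linearZ /= reflK.
Qed.

Lemma reflN a : s_ (- a) = s_ a.
Proof.
apply/lfunP => v; rewrite !reflE /cartan_int !linearNr linearNl /= opprK.
by rewrite mulrN mulNr scalerN scaleNr opprK.
Qed.

End Reflections.

(** * Generation of the Weyl group and of the root lattice by the simple roots *)

Section WeylGroupGeneration.
Variables (R : realType) (V : vectType R) (dot : {dot V for idfun}).
Variables (Phi : root_system dot) (n : nat) (alpha : base Phi n).
Local Notation s_ := (refl dot).

Lemma root_neq0 b : b \in Defs.roots Phi -> b != 0.
Proof. by move=> bP; apply: contraNneq (roots_neq0 Phi) => <-. Qed.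

Lemma simple_lin_indep (k : 'I_n -> R) :
  \sum_i k i *: alpha i = 0 -> forall i, k i = 0.
Proof.
have fr : free [tuple alpha i | i < n] by exact: basis_free (simple_basis alpha).
move=> k0; apply: (freeP fr); rewrite -{}[RHS]k0.
by apply: eq_bigr => i _; rewrite -tnth_nth tnth_mktuple.
Qed.

Lemma simple_coef_inj (k l : 'I_n -> R) :
  \sum_i k i *: alpha i = \sum_i l i *: alpha i -> k =1 l.
Proof.
move=> e i; apply/eqP; rewrite -subr_eq0; apply/eqP; move: i.
apply: simple_lin_indep; rewrite -[RHS](subrr (\sum_i l i *: alpha i)) -{1}e.
by rewrite -sumrB; apply: eq_bigr => i _; rewrite scalerBl.
Qed.

(** Otherwise every term of [dot b b], expanded as the sum of the [c i * dot b (alpha i)], would be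
    nonpositive. *)
Lemma positive_root_dot (c : 'I_n -> nat) :
  \sum_i alpha i *+ c i \in Defs.roots Phi ->
  exists2 i, 0 < dot (\sum_i alpha i *+ c i) (alpha i) & (0 < c i)%N.
Proof.
set b := \sum_i _ => bP; apply: contrapT => /forall2NP nopos.
have := @neq0_dnorm_gt0 _ _ _ dot _ (root_neq0 bP); rewrite ltNge => /negP; apply.
rewrite {2}/b linear_sumr sumr_le0 // => i _; rewrite raddfMn /=.
have [/negP|/negP] := nopos i; first by rewrite -leNgt => ?; rewrite mulrn_wle0.
by rewrite -eqn0Ngt => /eqP ->.
Qed.

(** Reflecting in a simple root of positive pairing [m] lowers the coefficient [i] by [m] and fixes
    the others: either the height drops, or the image is negative and the root was [alpha i]
    itself. *)
Lemma positive_root_descent (c : 'I_n -> nat) :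
  \sum_i alpha i *+ c i \in Defs.roots Phi ->
  exists i, \sum_i alpha i *+ c i = alpha i \/
    exists2 c', s_ (alpha i) (\sum_i alpha i *+ c i) = \sum_i alpha i *+ c' i &
      (\sum_i c' i < \sum_i c i)%N.
Proof.
move=> bP; have [i bi ci] := positive_root_dot bP; exists i.
set b := \sum_i _ in bP bi *.
have aP := simple_root alpha i; have a0 := root_neq0 aP.
set m := cartan_int dot b (alpha i).
have m0 : 0 < m by rewrite /m divr_gt0 ?mulr_gt0 ?neq0_dnorm_gt0.
have bE : b = \sum_j (c j)%:R *: alpha j.
  by apply: eq_bigr => j _; rewrite scaler_nat.
have sE : s_ (alpha i) b = \sum_j ((c j)%:R - m *+ (j == i)) *: alpha j.
  rewrite reflE -/m {1}bE; under [RHS]eq_bigr do rewrite scalerBl.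
  rewrite sumrB; congr (_ - _); rewrite (bigD1 i) //= eqxx big1 ?addr0 //.
  by move=> j /negPf ->; rewrite scale0r.
have [c' [c'E|c'E]] := simple_sign alpha (roots_refl aP bP).
  right; exists c' => //.
  have c'c j : (c' j)%:R = (c j)%:R - m *+ (j == i) :> R.
    move: j; apply: simple_coef_inj; rewrite -sE c'E.
    by apply: eq_bigr => j _; rewrite scaler_nat.
  rewrite (bigD1 i) //= [X in (_ < X)%N](bigD1 i) //=.
  rewrite -addSn leq_add //.
    by rewrite -(ltr_nat R) c'c eqxx ltrBlDr ltrDl.
  apply: leq_sum => j /negPf ji.
  by rewrite -(ler_nat R) c'c ji subr0.
(* If the image is negative, every coefficient other than [i] is both nonnegative and nonpositive,
   so [b] is a multiple of [alpha i]; reducedness leaves the factor 1, as -1 is not a natural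
   number. *)
left; have c'c j : - (c' j)%:R = (c j)%:R - m *+ (j == i) :> R.
  move: j; apply: simple_coef_inj; rewrite -sE c'E -sumrN.
  by apply: eq_bigr => j _; rewrite scaleNr scaler_nat.
have b1 : b = (c i)%:R *: alpha i.
  rewrite bE (bigD1 i) //= big1 ?addr0 // => j /negPf ji.
  have := c'c j; rewrite ji subr0 => e.
  suff -> : (c j)%:R = 0 :> R by rewrite scale0r.
  by apply/eqP; rewrite eq_le ler0n andbT -e oppr_le0 ler0n.
have := bP; rewrite b1 => /(roots_reduced aP) [-> | e]; first by rewrite scale1r.
by have := ler0n R (c i); rewrite e ler0N1.
Qed.

(** Induction on the height of a positive root reaches every reflection, hence every product of
    reflections. The membership premises of the product case allow a [P] that quantifies over proofs
    of membership. *)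
Lemma weyl_simple_ind (P : 'End(V) -> Prop) :
  P \1%VF -> (forall i, P (s_ (alpha i))) ->
  (forall g h, g \in weyl_pred Phi -> h \in weyl_pred Phi ->
     P g -> P h -> P (g \o h)%VF) ->
  forall g, g \in weyl_pred Phi -> P g.
Proof.
move=> P1 Ps PM.
have Ppos N c : (\sum_i c i < N)%N -> \sum_i alpha i *+ c i \in Defs.roots Phi ->
    P (s_ (\sum_i alpha i *+ c i)).
  elim: N c => // N IHN c cN bP.
  have [i [-> // | [c' c'E c'c]]] := positive_root_descent bP.
  have aP := simple_root alpha i; have a0 := root_neq0 aP.
  have b'P := roots_refl aP bP; rewrite c'E in b'P.
  (* With [b'] the lower root [s_ (alpha i) b], the reflection in [b] is the conjugate of that in
     [b'] by [s_ (alpha i)]. *)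
  rewrite -[X in s_ X](reflK dot a0) c'E refl_conj //.
  have Pb' : P (s_ (\sum_i alpha i *+ c' i)).
    by apply: IHN => //; apply: leq_trans c'c _.
  have [sW bW] := (weyl_pred_refl aP, weyl_pred_refl b'P).
  exact: PM sW (weyl_predM bW sW) (Ps i) (PM _ _ bW sW Pb' (Ps i)).
have Proot b : b \in Defs.roots Phi -> P (s_ b).
  move=> bP; have [c [e | e]] := simple_sign alpha bP.
    by rewrite e in bP *; apply: Ppos bP.
  have bNP : \sum_i alpha i *+ c i \in Defs.roots Phi.
    rewrite -[X in X \in _]opprK -e -(refl_fun_self dot (root_neq0 bP)).
    exact: roots_refl.
  by rewrite e reflN; apply: Ppos bNP.
move=> g /asboolP[s sP ->]; elim: s sP => [|b s IHs] sP.
  by rewrite big_nil.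
have bP : b \in Defs.roots Phi by apply/sP/mem_head.
have sP' : {subset s <= Defs.roots Phi} by move=> ? ?; apply/sP/mem_behead.
rewrite big_cons; apply: PM;
  [exact: weyl_pred_refl | | exact: Proot | exact: IHs].
by apply/asboolP; exists s.
Qed.

Lemma lattice_simple_span (z : root_lattice Phi) :
  exists c : 'I_n -> int, val z = \sum_i alpha i *~ c i.
Proof.
have [k ->] : inIntSpan (in_tuple (Defs.roots Phi)) (val z) by apply/asboolP/(valP z).
elim/big_ind: _ => [|_ _ [c ->] [d ->]|i _].
- by exists (fun=> 0); rewrite big1.
- exists (fun i => c i + d i); rewrite -big_split.
  by apply: eq_bigr => i _; rewrite mulrzDr.
have [c e] : exists c : 'I_n -> int, (Defs.roots Phi)`_i = \sum_i alpha i *~ c i.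
  have [c [->|->]] := simple_sign alpha (mem_nth 0 (ltn_ord i)).
    by exists (fun i => c i).
  exists (fun i => - (c i)%:Z); rewrite -sumrN.
  by apply: eq_bigr => j _; rewrite mulrNz.
exists (fun j => c j * k i); rewrite /= e mulrz_suml.
by apply: eq_bigr => j _; rewrite mulrzA.
Qed.

End WeylGroupGeneration.

(** * Integral linear algebra of the Cartan matrix of type C *)

Lemma sum_ord_pick (S : pzSemiRingType) (n m : nat) (F : nat -> S) :
  \sum_(i < n) F i * (i == m :> nat)%:R = if (m < n)%N then F m else 0.
Proof.
case: ltnP => [mn | nm].
  rewrite (bigD1 (Ordinal mn)) //= eqxx mulr1 big1 ?addr0 // => i ni.
  by rewrite -[X in (X == _)]/(val i) (negPf ni : (val i == m) = false) mulr0.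
rewrite big1 // => i _; have /ltn_eqF -> : (i < m)%N by exact: leq_trans nm.
by rewrite mulr0.
Qed.

(** Column [j] is supported on the rows [j - 1], [j] and [j + 1]; the factor 2 appears when row
    [j + 1] is the last one. *)
Lemma sum_mul_cartanC n (c : nat -> int) (j : nat) : (j < n)%N ->
  \sum_(i < n) c i * cartanC n i j =
    2 * c j - (if j is k.+1 then c k else 0)
    - (if (j.+1 < n)%N then c j.+1 * (if j.+2 == n then 2 else 1) else 0).
Proof.
move=> jn; pose u (i : nat) : int := if i.+1 == n then 2 else 1.
transitivity (\sum_(i < n) (2 * c i * (i == j :> nat)%:R
    - (if j is k.+1 then c i * (i == k :> nat)%:R else 0)
    - c i * u i * (i == j.+1 :> nat)%:R)).
  apply: eq_bigr => i _; rewrite /cartanC /u.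
  case: j jn => [|k] jn; rewrite ?eqSS;
    case: (ltngtP (val i) _) => /=; repeat case: eqP => //=; try lia.
rewrite !sumrB (sum_ord_pick _ _ (fun i => 2 * c i)) jn.
rewrite (sum_ord_pick _ _ (fun i => c i * u i)) /u; congr (_ - _ - _).
case: j jn => [|k] kn; first by rewrite big1.
by rewrite sum_ord_pick ltnW.
Qed.

(** In the numbering from 1, an odd row meets the odd columns only in its diagonal entry 2. An even
    row meets them in its neighbours: two entries -1, or a single -2 in the last row. *)
Lemma sum_odd_cartanC n i : (i < n)%N ->
  \sum_(j < n | odd j.+1) (cartanC n i j)%:~R = 0 :> 'Z_2.
Proof.
move=> lt_in; have Z2 (x : 'Z_2) : x + x = 0 by case: x => [[|[|]]] // ?;
  apply/val_inj.
rewrite big_mkcond.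
(* Modulo 2 only the entries -1 survive, and they become 1. *)
transitivity (\sum_(j < n) ((odd j.+1)%:R * (j == i.+1 :> nat)%:R +
  (if i is k.+1 then (odd j.+1 && (i.+1 != n))%:R * (j == k :> nat)%:R else 0))
   : 'Z_2).
  apply: eq_bigr => j _; rewrite /cartanC.
  case: i lt_in => [|k] kn; case: (odd _) => //=;
  repeat case: eqP => //=; try lia; try by move=> *; apply/val_inj.
rewrite big_split /= (sum_ord_pick _ _ (fun j => (odd j.+1)%:R)).
case: i lt_in => [|k] kn; first by rewrite big1 // addr0; case: ifP.
rewrite (sum_ord_pick _ _ (fun j => (odd j.+1 && (k.+2 != n))%:R)) (ltnW kn) /=.
rewrite negbK ltn_neqAle kn; case: eqP => _; first by rewrite andbF addr0.
by rewrite /= andbT Z2.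
Qed.

Lemma intr_Z2_neq1 (m : int) : (m%:~R : 'Z_2) != 1 -> exists q, m = 2 * q.
Proof.
move=> m1; exists (m %/ 2)%Z; rewrite {1}(divz_eq m 2) mulrC.
have := modz_ge0 m (isT : 2 != 0 :> int); have := @ltz_pmod m 2 isT.
case Er: (m %% 2)%Z => [[|[|k]]|k] // _ _; first by rewrite addr0.
case/eqP: m1; rewrite (divz_eq m 2) Er rmorphD rmorphM /=.
have -> : (2 : int)%:~R = 0 :> 'Z_2 by apply/val_inj.
by rewrite mulr0 add0r.
Qed.

(* In the coordinates z = x_0 e_0 + ... + x_(n-1) e_(n-1), with simple roots
   e_i - e_(i+1) and 2 e_(n-1), the equations say x_j = - (d_j + ... + d_(n-1));
   such a z lies in the root lattice iff the sum of the x_j is even. *)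
Lemma cartanC_solve n (d : 'I_n -> int) :
  \sum_(k < n | odd k.+1) ((d k)%:~R : 'Z_2) != 1 ->
  exists c : 'I_n -> int, forall j : 'I_n, \sum_i c i * cartanC n i j = - d j.
Proof.
move=> dP.
pose x j : int := - \sum_(k < n | (j <= k)%N) d k.
pose y m : int := \sum_(j < m) x j.
have yS m : y m.+1 = y m + x m by rewrite /y big_ord_recr.
have xB (j : 'I_n) : x j - x j.+1 = - d j.
  rewrite /x opprK [in X in - X](bigD1 j) //= opprD -addrA.
  rewrite [X in _ + (- X + _)](eq_bigl (fun k : 'I_n => (j < k)%N)) ?addNr ?addr0 //.
  by move=> k; rewrite [RHS]ltn_neqAle andbC eq_sym.
(* [d k] occurs in [x j] exactly for [j <= k], hence [k + 1] times in [y n], which modulo 2 keeps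
   the odd [k + 1]. *)
have yn : (y n)%:~R = - \sum_(k < n | odd k.+1) ((d k)%:~R : 'Z_2).
  rewrite /y /x sumrN rmorphN rmorph_sum /=; congr (- _).
  under eq_bigr do rewrite rmorph_sum /= big_mkcond.
  rewrite exchange_big [RHS]big_mkcond; apply: eq_bigr => k _ /=.
  rewrite -big_mkcond /=.
  transitivity (\sum_(j < k.+1) ((d k)%:~R : 'Z_2)).
    by rewrite (big_ord_widen n (fun=> (d k)%:~R)).
  rewrite sumr_const card_ord -mulr_natr -Zp_nat_mod //= modn2 /=.
  by case: odd; rewrite ?mulr1 ?mulr0.
have [q yq] : exists q, y n = 2 * q.
  apply: intr_Z2_neq1; rewrite yn; move: dP; set s := \sum_(_ < _ | _) _.
  by case: s => [[|[|]]].
(* The coefficient of a short simple root is a partial sum of coordinates; the last one is halved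
   because the long root is [2 e_(n-1)]. *)
pose c i := if i.+1 == n then q else y i.+1.
exists (fun i => c i) => j; rewrite sum_mul_cartanC // -xB.
have -> : (if (j : nat) is k.+1 then c k else 0) = y j.
  case: (nat_of_ord j) (ltn_ord j) => [|k] kn; first by rewrite /y big_ord0.
  by rewrite /c ltn_eqF.
have xn : x n = 0 by rewrite /x big1 ?oppr0 // => k; rewrite leqNgt ltn_ord.
rewrite /c; have [jn|jn] := eqVneq j.+1 n.
  by rewrite jn ltnn xn -yq -[in y n]jn yS; ring.
(* In the column before the last, the entry -2 of the last row undoes the halving in [q]. *)
rewrite ltn_neqAle jn ltn_ord; have [j2n|_] := eqVneq j.+2 n.
  by rewrite /= [q * _]mulrC -yq -[in y n]j2n !yS; ring.
by rewrite /= !yS; ring.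
Qed.

(** * The coboundary condition on simple reflections *)

Section SectionsOnSimpleReflections.
Variables (R : realType) (V : vectType R) (dot : {dot V for idfun}).
Variables (n : nat) (Phi : root_system dot) (alpha : base Phi n).
Local Notation A := (weyl_act Phi).

Lemma lattice_simple_mulz_inj j :
  injective (fun m => lattice_simple alpha j *~ m).
Proof.
move=> m1 m2 /(congr1 val); rewrite !raddfMz /= => /eqP.
rewrite -!scaler_int -subr_eq0 -scalerBl scaler_eq0.
rewrite (negPf (root_neq0 (simple_root alpha j))) orbF subr_eq0.
by rewrite eqr_int => /eqP.
Qed.

(** The pairing of [z] with the coroot of [alpha j] is linear in [z], so it is the entry [j] of the
    row vector [c] times the Cartan matrix. *)
Lemma weyl_simple_actB (z : root_lattice Phi) (c : 'I_n -> int) j :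
  type_C alpha -> val z = \sum_i alpha i *~ c i ->
  A (weyl_simple alpha j) z - z =
    - (lattice_simple alpha j *~ (\sum_i c i * cartanC n i j)).
Proof.
move=> PhiC zE; apply/val_inj.
rewrite raddfB raddfN raddfMz /= reflE addrAC subrr add0r; congr (- _).
rewrite -scaler_int; congr (_ *: _).
rewrite zE /cartan_int dotC linear_sumr /= mulr_sumr mulr_suml rmorph_sum /=.
apply: eq_bigr => i _; rewrite -scaler_int linearZr_LR /= rmorphM /= -PhiC dotC.
by rewrite /cartan_int mulrCA !mulrA.
Qed.

(** Both sides satisfy the cocycle identity, so the elements where they agree are closed under
    products. *)
Lemma gsection_simple_diffP (s1 s2 : gsection A) z :
  (forall g, (s1 g).1 - (s2 g).1 = A g z - z) <->
  (forall j, (s1 (weyl_simple alpha j)).1 - (s2 (weyl_simple alpha j)).1 =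
     A (weyl_simple alpha j) z - z).
Proof.
split=> [//|hs]; pose P g := (s1 g).1 - (s2 g).1 = A g z - z.
have PM g h : P g -> P h -> P (g * h)%g.
  rewrite /P !gsection_fstM => Pg Ph.
  rewrite opprD addrACA Pg -zactN -zactD Ph.
  by rewrite zactM zactD zactN addrC addrA subrK.
suff Pg g : g \in weyl_pred Phi -> forall gW, P (Sub g gW).
  by case=> g gW; apply: Pg.
move: g; apply: (weyl_simple_ind (alpha := alpha)) => [gW|j gW|g h gW hW Pg Ph ghW].
- have -> : (Sub \1%VF gW : weyl Phi) = 1%g by exact/val_inj.
  by rewrite /P !gsection_fst1 zact1 !subrr.
- have -> : (Sub (refl dot (alpha j)) gW : weyl Phi) = weyl_simple alpha j.
    exact/val_inj.
  exact: hs.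
- have -> : (Sub (g \o h)%VF ghW : weyl Phi) =
      ((Sub g gW : weyl Phi) * (Sub h hW : weyl Phi))%g by exact/val_inj.
  by apply: PM; [apply: Pg | apply: Ph].
Qed.

End SectionsOnSimpleReflections.

Theorem proposition3p4 (R : realType) (V : vectType R) (dot : {dot V for idfun})
    (n : nat) (Phi : root_system dot) (alpha : base Phi n)
    (n_ge2 : (2 <= n)%N) (PhiC : type_C alpha)
    (s1 s2 : gsection (weyl_act Phi)) (a b d : 'I_n -> int)
    (s1E : forall i, s1 (weyl_simple alpha i) =
       (sd_transl (weyl_act Phi) (lattice_simple alpha i *~ a i) *
        sd_lift (weyl_act Phi) (weyl_simple alpha i))%g)
    (s2E : forall i, s2 (weyl_simple alpha i) =
       (sd_transl (weyl_act Phi) (lattice_simple alpha i *~ b i) *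
        sd_lift (weyl_act Phi) (weyl_simple alpha i))%g)
    (dE : forall i, d i = a i - b i) :
  H1_class s1 <> H1_class s2 <->
  \sum_(k < n | odd k.+1) ((d k)%:~R : 'Z_2) = 1.
Proof.
have dsE j : (s1 (weyl_simple alpha j)).1 - (s2 (weyl_simple alpha j)).1 =
    lattice_simple alpha j *~ d j.
  by rewrite s1E s2E !sd_transl_lift_fst dE mulrzBr.
split.
  (* By contraposition: if the sum is not 1, the system is solvable and its solution gives a [z]
     that identifies the two classes. *)
  move=> ne; apply/eqP/negPn/negP => /cartanC_solve[c cE].
  apply/ne/H1_class_eqP; exists (\sum_i lattice_simple alpha i *~ c i).
  apply/(gsection_simple_diffP alpha) => j; rewrite dsE.
  rewrite (weyl_simple_actB (c := c)) ?cE ?mulrNz ?opprK //.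
  by rewrite raddf_sum; apply: eq_bigr => i _; rewrite raddfMz.
move=> d1 /H1_class_eqP [z] /(gsection_simple_diffP alpha) hz.
have [c zE] := lattice_simple_span alpha z.
have dc j : d j = - \sum_i c i * cartanC n i j.
  apply: (lattice_simple_mulz_inj (alpha := alpha) (j := j)).
  by rewrite mulrNz -(weyl_simple_actB j PhiC zE) -hz dsE.
suff : \sum_(k < n | odd k.+1) ((d k)%:~R : 'Z_2) = 0 by rewrite d1.
under eq_bigr do rewrite dc rmorphN rmorph_sum.
(* After the exchange, each [c i] multiplies the sum of row [i] over the odd-numbered columns, which
   vanishes modulo 2. *)
rewrite sumrN exchange_big big1 ?oppr0 // => i _.
under eq_bigr do rewrite rmorphM; rewrite -mulr_sumr /=.
by rewrite sum_odd_cartanC // mulr0.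
Qed.
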